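(* Let $\Delta=\langle a_1,a_2,a_3,b : a_i^2=b^3=a_iba_ib=e\ (i=1,2,3)\rangle$ with generating set $F=\{a_1,a_2,a_3,b\}$. Then $\mathrm{Cay}(\Delta,F)$ does not admit a $\Delta$-fiid approximate $3$-coloring.
   Context: $\mathrm{Cay}(\Delta,F)$ is the graph with vertex set $\Delta$ in which $x$ is adjacent to $\gamma x$ for $\gamma\in F\cup F^{-1}$. $\Delta$ acts on $[0,1]^\Delta$ and on $\{1,2,3\}^\Delta$ by $(\gamma\cdot x)(\delta)=x(\delta\gamma)$. A $\Delta$-fiid vertex labelling by $\{1,2,3\}$ is a measurable map $\mathbf f:([0,1]^\Delta,\lambda^\Delta)\to\{1,2,3\}^\Delta$ ($\lambda$ Lebesgue measure) that is $\Delta$-equivariant almost everywhere. A $\Delta$-fiid approximate $3$-coloring is a sequence $(\mathbf f_i)_{i\in\mathbb N}$ of such labellings with $\mathbb P\big(\mathbf f_i(e)\neq\mathbf f_i(\gamma)\text{ for every neighbour }\gamma\text{ of }e\big)\to1$ as $i\to\infty$. *)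

(* Defs.v *)
From HB Require Import structures.
From mathcomp Require Import all_boot all_order all_algebra.
From mathcomp Require Import all_classical all_reals all_analysis.

Set Implicit Arguments.
Unset Strict Implicit.
Unset Printing Implicit Defensive.
Import Order.TTheory GRing.Theory Num.Theory.

Local Open Scope classical_set_scope.
Local Open Scope quotient_scope.

Section Presentation.
Variable X : choiceType.

(* The letter (x, false) stands for x, and (x, true) for its inverse. *)
Definition letter := (X * bool)%type.
Definition word := seq letter.

Definition pos_word (x : X) : word := [:: (x, false)].
Definition inv_letter (l : letter) : letter := (l.1, ~~ l.2).
Definition inv_word (w : word) : word := rev (map inv_letter w).

Variable rels : set word.

Inductive pres_eq : word -> word -> Prop :=
| pres_refl u : pres_eq u u
| pres_sym u v : pres_eq u v -> pres_eq v u
| pres_trans u v w : pres_eq u v -> pres_eq v w -> pres_eq u w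
| pres_cancel u v l : pres_eq (u ++ l :: inv_letter l :: v) (u ++ v)
| pres_rel u v r : rels r -> pres_eq (u ++ r ++ v) (u ++ v).

Lemma pres_eq_catl w u v : pres_eq u v -> pres_eq (w ++ u) (w ++ v).
Proof.
elim=> {u v} [u|u v _|u v z _ uv _|u v l|u v r rr].
- exact: pres_refl.
- exact: pres_sym.
- exact: pres_trans.
- by rewrite !catA; exact: pres_cancel.
- by rewrite (catA w u) (catA w u); exact: pres_rel.
Qed.

Lemma pres_eq_catr w u v : pres_eq u v -> pres_eq (u ++ w) (v ++ w).
Proof.
elim=> {u v} [u|u v _|u v z _ uv _|u v l|u v r rr].
- exact: pres_refl.
- exact: pres_sym.
- exact: pres_trans.
- by rewrite -!catA /=; exact: pres_cancel.
- by rewrite -!catA; exact: pres_rel.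
Qed.

Lemma pres_eq_cat u u' v v' :
  pres_eq u u' -> pres_eq v v' -> pres_eq (u ++ v) (u' ++ v').
Proof.
move=> uu' vv'; apply: pres_trans (pres_eq_catr _ uu') _.
exact: pres_eq_catl.
Qed.

Lemma inv_letterK : involutive inv_letter.
Proof. by case=> x b; rewrite /inv_letter /= negbK. Qed.

Lemma inv_wordK : involutive inv_word.
Proof.
by move=> w; rewrite /inv_word map_rev revK -map_comp map_id_in// => l _ /=;
  rewrite inv_letterK.
Qed.

Lemma inv_word_cat u v : inv_word (u ++ v) = inv_word v ++ inv_word u.
Proof. by rewrite /inv_word map_cat rev_cat. Qed.

Lemma pres_mulwV w : pres_eq (w ++ inv_word w) [::].
Proof.
elim: w => [|l w IHw]; first exact: pres_refl.
rewrite -cat1s inv_word_cat -catA (catA w).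
apply: (pres_trans (v := [:: l] ++ inv_word [:: l])).
  exact/pres_eq_catl/(pres_eq_catr _ IHw).
exact: (pres_cancel [::] [::]).
Qed.

Lemma pres_mulVw w : pres_eq (inv_word w ++ w) [::].
Proof. by rewrite -{2}(inv_wordK w); exact: pres_mulwV. Qed.

Lemma pres_eq_inv u v : pres_eq u v -> pres_eq (inv_word u) (inv_word v).
Proof.
move=> uv; rewrite -(cats0 (inv_word u)).
apply: pres_trans (pres_eq_catl _ (pres_sym (pres_mulwV v))) _.
rewrite catA; apply: (pres_eq_catr _ (v := [::])).
exact: pres_trans (pres_eq_catl _ (pres_sym uv)) (pres_mulVw u).
Qed.

Definition pres_eqb : rel word := fun u v => `[< pres_eq u v >].

Lemma pres_eqb_refl : reflexive pres_eqb.
Proof. by move=> u; exact/asboolP/pres_refl. Qed.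

Lemma pres_eqb_sym : symmetric pres_eqb.
Proof. by move=> u v; apply/asboolP/asboolP; exact: pres_sym. Qed.

Lemma pres_eqb_trans : transitive pres_eqb.
Proof. by move=> v u w /asboolP uv /asboolP vw; exact/asboolP/(pres_trans uv). Qed.

Canonical pres_equiv := EquivRel pres_eqb pres_eqb_refl pres_eqb_sym pres_eqb_trans.

(* The group presented by the generators X and the relators rels. *)
Definition presented : Type := {eq_quot pres_equiv}.

HB.instance Definition _ := Choice.on presented.

Definition pres_class (w : word) : presented := \pi_{eq_quot pres_equiv} w.
Definition pres_gen (x : X) : presented := pres_class (pos_word x).

Lemma pres_classP u v : pres_class u = pres_class v <-> pres_eq u v.
Proof. by split=> [/eqmodP/asboolP|uv]; last exact/eqmodP/asboolP. Qed.

Definition pres_word (g : presented) : word := repr (g : {eq_quot pres_equiv}).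

Lemma pres_wordK : cancel pres_word pres_class.
Proof. by move=> g; exact: reprK. Qed.

Lemma pres_classK w : pres_eq (pres_word (pres_class w)) w.
Proof. by apply/pres_classP; rewrite pres_wordK. Qed.

Definition pres_one := pres_class [::].
Definition pres_mul (g h : presented) :=
  pres_class (pres_word g ++ pres_word h).
Definition pres_inv (g : presented) := pres_class (inv_word (pres_word g)).

Lemma pres_mulE u v : pres_mul (pres_class u) (pres_class v) = pres_class (u ++ v).
Proof. by apply/pres_classP/pres_eq_cat; exact: pres_classK. Qed.

Lemma pres_invE u : pres_inv (pres_class u) = pres_class (inv_word u).
Proof. by apply/pres_classP/pres_eq_inv; exact: pres_classK. Qed.

Lemma pres_mulA : associative pres_mul.
Proof.
move=> f g h; rewrite -(pres_wordK f) -(pres_wordK g) -(pres_wordK h).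
by rewrite !pres_mulE catA.
Qed.

Lemma pres_mul1 : left_id pres_one pres_mul.
Proof. by move=> g; rewrite -(pres_wordK g) pres_mulE. Qed.

Lemma pres_mulr1 : right_id pres_one pres_mul.
Proof. by move=> g; rewrite -(pres_wordK g) pres_mulE cats0. Qed.

Lemma pres_mulV : left_inverse pres_one pres_inv pres_mul.
Proof.
move=> g; rewrite -(pres_wordK g) pres_invE pres_mulE.
exact/pres_classP/pres_mulVw.
Qed.

Lemma pres_mulrV : right_inverse pres_one pres_inv pres_mul.
Proof.
move=> g; rewrite -(pres_wordK g) pres_invE pres_mulE.
exact/pres_classP/pres_mulwV.
Qed.

HB.instance Definition _ := isGroup.Build presented
  pres_mulA pres_mul1 pres_mulr1 pres_mulV pres_mulrV.

End Presentation.

Section Delta.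

(* Some i is the generator a_(i+1), and None is b. *)
Definition Delta_letter := option 'I_3.

Definition wa (i : 'I_3) : word Delta_letter := pos_word (Some i).
Definition wb : word Delta_letter := pos_word None.

Definition Delta_rels : set (word Delta_letter) :=
  [set w | [\/ exists i, w = wa i ++ wa i,
               w = wb ++ wb ++ wb |
               exists i, w = wa i ++ wb ++ wa i ++ wb]].

Definition Delta : groupType := presented Delta_rels.

Definition Delta_a (i : 'I_3) : Delta := pres_gen _ (Some i).
Definition Delta_b : Delta := pres_gen _ None.

Definition Delta_F : set Delta := range Delta_a `|` [set Delta_b].

End Delta.

Definition power_display : measure_display -> measure_display.
Proof. exact. Qed.

Section PowerSpace.
Context (I : Type) d (T : measurableType d).

Definition coordinate (i : I) (x : I -> T) : T := x i.

Definition cylinders : set (set (I -> T)) :=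
  \bigcup_i preimage_set_system setT (coordinate i) measurable.

(* I -> T with the product sigma-algebra. *)
Definition power_space := I -> T.

HB.instance Definition _ := Pointed.on power_space.
HB.instance Definition _ := @isMeasurable.Build (power_display d) power_space
  <<s cylinders >> (@sigma_algebra0 _ setT cylinders)
  (@sigma_algebraC _ cylinders) (@sigma_algebra_bigcup _ setT cylinders).

(* mu is the product measure nu^I, i.e. the (unique) probability measure on the
   product sigma-algebra with these values on the finite-dimensional boxes. *)
Definition is_power_measure (R : realType) (nu : probability T R)
    (mu : probability power_space R) : Prop :=
  forall (n : nat) (i : 'I_n -> I) (A : 'I_n -> set T),
    injective i -> (forall k, measurable (A k)) ->
    mu [set x | forall k, A k (x (i k))] = (\prod_(k < n) nu (A k))%E.

End PowerSpace.

Section UnitInterval.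
Variable R : realType.

HB.instance Definition _ :=
  isPointed.Build {i01 R} (Itv01 (lexx (0 : R)%R) ler01).

Definition unit_val (x : {i01 R}) : measurableTypeR R := (x%:num)%R.

(* [0, 1] with its Borel sets. *)
Definition unit_itv := {i01 R}.

HB.instance Definition _ := Pointed.on unit_itv.
HB.instance Definition _ := @isMeasurable.Build default_measure_display unit_itv
  (g_sigma_algebra_preimage unit_val)
  (@measurable0 _ (g_sigma_algebra_preimageType unit_val))
  (@measurableC _ (g_sigma_algebra_preimageType unit_val))
  (@bigcupT_measurable _ (g_sigma_algebra_preimageType unit_val)).

Definition unit_lebesgue (A : set unit_itv) : \bar R :=
  lebesgue_measure (unit_val @` A).

Lemma range_unit_val : range unit_val = `[0%R, 1%R].
Proof.
apply/seteqP; split=> [y [x _ <-]|x].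
  by rewrite /= in_itv /= /unit_val; apply/andP; split.
by rewrite /= in_itv /= => /andP[x0 x1]; exists (Itv01 x0 x1).
Qed.

Lemma unit_val_inj : injective unit_val.
Proof. by move=> x y /val_inj. Qed.

Lemma measurable_unit_val_image (A : set unit_itv) :
  measurable A -> measurable (unit_val @` A).
Proof.
case=> B mB <-; rewrite setTI.
have -> : unit_val @` (unit_val @^-1` B) = B `&` range unit_val.
  apply/seteqP; split=> [y [x Bx <-]|y [By [x _ xy]]].
    by split; last exists x.
  by exists x => //; rewrite /preimage /= xy.
by apply: measurableI => //; rewrite range_unit_val; exact: measurable_itv.
Qed.

Let unit_lebesgue0 : unit_lebesgue set0 = 0%E.
Proof. by rewrite /unit_lebesgue image_set0 measure0. Qed.

Let unit_lebesgue_ge0 A : (0 <= unit_lebesgue A)%E.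
Proof. exact: measure_ge0. Qed.

Let unit_lebesgue_sigma_additive : semi_sigma_additive unit_lebesgue.
Proof.
move=> F mF tF mUF; rewrite /unit_lebesgue image_bigcup.
apply: measure_semi_sigma_additive.
- by move=> n; exact: measurable_unit_val_image.
- apply/trivIsetP => i j _ _ ij; apply/seteqP; split=> // z [[x Fx <-] [y Fy]].
  move=> /unit_val_inj yx; move: Fy; rewrite yx => Fy.
  by move/trivIsetP : tF => /(_ i j I I ij) /seteqP[+ _] => /(_ x); exact.
- by rewrite -image_bigcup; exact: measurable_unit_val_image.
Qed.

HB.instance Definition _ := isMeasure.Build _ _ _ unit_lebesgue
  unit_lebesgue0 unit_lebesgue_ge0 unit_lebesgue_sigma_additive.

Let unit_lebesgueT : unit_lebesgue setT = 1%E.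
Proof.
by rewrite /unit_lebesgue range_unit_val lebesgue_measure_itv /= lte_fin ltr01 sube0.
Qed.

HB.instance Definition _ :=
  Measure_isProbability.Build _ _ _ unit_lebesgue unit_lebesgueT.

End UnitInterval.

(* 'I_3 = {0, 1, 2} plays the role of the set of colours {1, 2, 3}. *)
HB.instance Definition _ := isPointed.Build 'I_3 ord0.
HB.instance Definition _ := @isMeasurable.Build default_measure_display
  'I_3 discrete_measurable discrete_measurable0
  discrete_measurableC discrete_measurableU.

Section Fiid.
Local Open Scope group_scope.
Variables (R : realType) (G : groupType).

Definition cayley_adj (F : set G) (x y : G) : Prop :=
  exists2 c, F c \/ F c^-1 & y = c * x.

Definition translate (T : Type) (c : G) (x : G -> T) : G -> T := fun h => x (h * c).

Definition cube := power_space G (unit_itv R).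
Definition labellings := power_space G 'I_3.

HB.instance Definition _ := Measurable.on cube.
HB.instance Definition _ := Measurable.on labellings.

Variable mu : probability cube R.

Definition fiid_labelling (f : cube -> labellings) : Prop :=
  measurable_fun setT f /\
  {ae mu, forall x : cube, forall c : G, f (translate c x) = translate c (f x)}.

Definition properly_coloured_at1 (F : set G) (f : cube -> labellings) : set cube :=
  [set x | forall c : G, cayley_adj F 1 c -> f x 1 <> f x c].

Definition fiid_approx_coloring (F : set G) (f : nat -> cube -> labellings) : Prop :=
  (forall i, fiid_labelling (f i)) /\
  (fun i => mu (properly_coloured_at1 F (f i))) @ \oo --> 1%E.

End Fiid.

(* Main.v *)
Require Import Defs.
From mathcomp Require Import all_boot all_order all_algebra.
From mathcomp Require Import all_classical all_reals all_analysis.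
From mathcomp Require Import measurable_realfun ring lra.

(** Why an approximate 3-colouring cannot exist.

    The element b generates a normal subgroup of order 3, and the quotient is
    the free product of three groups of order 2, whose Cayley graph is the
    3-regular tree. So the Cayley graph of Delta consists of triangles
    {x, b x, b^2 x}, one at each vertex of the tree, and triangles at adjacent
    vertices are joined by a matching x -- a_i x. As a_i b = b^-1 a_i, this
    matching reverses the cyclic order that multiplication by b puts on a
    triangle. In a proper 3-colouring the colours of a triangle occur in one of
    two cyclic orders; along the matching every colour changes, so the colours
    undergo a rotation, and the cyclic order read in the direction of b gets
    reversed ([prism_cyclic3]). A fiid colouring f therefore yields a function
    [orientation] h with values -1, 0, 1 such that h (a_i x) = - h x as soon as
    f is proper at five vertices near x ([orientation_flip]): an approximate
    2-colouring of the tree.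

    This contradicts the spectral gap of the Bernoulli shift
    ([approximable_gap]): writing A h for the sum of the three translates
    x |-> h (a_i x), one has |cov (h, A h)| <= (17/6) Var h, whereas h above
    would make cov (h, A h) at most -3 + o(1) while Var h <= 1.

    The gap comes from the weight W c = (2/3)^|c|, with |c| the distance in the
    tree from the image of c to the root: it satisfies
    W (a_1 c) + W (a_2 c) + W (a_3 c) <= (17/6) W c ([tree_weight_super]). If h
    depends on finitely many coordinates, then h and x |-> h (c x) are
    independent for all but finitely many c, so their covariance is at most
    C W c ([cov_cylindrical_decay]); hence q n = cov (h, A^n h) is at most
    C' (17/6)^n. Because A is self-adjoint, q n ^ 2 <= q 0 * q (2 n), and along
    the powers of 2 this inequality turns the exponential growth rate of q into
    the bound |q 1| <= (17/6) q 0, with no constant left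
    ([moment_growth_bound]). An L^2 approximation extends the bound to all the
    functions needed. *)

Set Implicit Arguments.
Unset Strict Implicit.
Unset Printing Implicit Defensive.
Import Order.TTheory GRing.Theory Num.Theory.
Import numFieldNormedType.Exports.

Local Open Scope classical_set_scope.
Local Open Scope ring_scope.

(** * Covariance of bounded random variables *)

Section Covariance.
Context d (T : measurableType d) (R : realType) (P : probability T R).
Implicit Types (f g h : T -> R) (A B : set T).

(** Boundedness makes every integral below finite, so that real-valued
    integrals are linear and monotone without integrability side conditions. *)
Definition bounded_measurable f :=
  measurable_fun setT f /\ exists M, forall x, `|f x| <= M.

Local Notation bm := bounded_measurable.

Lemma bm_cst c : bm (fun=> c).
Proof. by split; [exact: measurable_cst | exists `|c|]. Qed.

Lemma bm_indic A : measurable A -> bm \1_A.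
Proof.
move=> mA; split; first exact: measurable_indic.
by exists 1 => x; rewrite indicE; case: (_ \in _); rewrite /= (normr0, normr1).
Qed.

Lemma bmD f g : bm f -> bm g -> bm (fun x => f x + g x).
Proof.
move=> [mf [M fM]] [mg [N gN]]; split; first exact: measurable_funD.
by exists (M + N) => x; rewrite (le_trans (ler_normD _ _))// lerD.
Qed.

Lemma bmM f g : bm f -> bm g -> bm (fun x => f x * g x).
Proof.
move=> [mf [M fM]] [mg [N gN]]; split; first exact: measurable_funM.
by exists (M * N) => x; rewrite normrM ler_pM.
Qed.

Lemma bmZ c f : bm f -> bm (fun x => c * f x).
Proof. by move=> bf; apply: bmM => //; exact: bm_cst. Qed.

Lemma bmB f g : bm f -> bm g -> bm (fun x => f x - g x).
Proof.
move=> bf bg; under [X in bm X]funext => x do rewrite -mulN1r.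
by apply: bmD => //; exact: bmZ.
Qed.

Lemma bm_sum I (r : seq I) (F : I -> T -> R) :
  (forall i, bm (F i)) -> bm (fun x => \sum_(i <- r) F i x).
Proof.
move=> bF; elim: r => [|i r IHr].
  by under [X in bm X]funext do rewrite big_nil; exact: bm_cst.
by under [X in bm X]funext do rewrite big_cons; exact: bmD.
Qed.

Lemma bm_integrable f : bm f -> P.-integrable setT (EFin \o f).
Proof.
move=> [mf [M fM]]; apply: measurable_bounded_integrable => //.
- exact: le_lt_trans (probability_le1 P measurableT) (ltry 1).
- exists M; split; first exact: num_real.
  by move=> N MN x _; apply: le_trans (fM x) _; exact: ltW.
Qed.

Local Notation "'E' f" := (\int[P]_x f x) (at level 10, f at level 9).

Lemma expD f g : bm f -> bm g -> \int[P]_x (f x + g x) = E f + E g.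
Proof. by move=> bf bg; rewrite RintegralD//; exact: bm_integrable. Qed.

Lemma expZ c f : bm f -> \int[P]_x (c * f x) = c * E f.
Proof. by move=> bf; rewrite RintegralZl//; exact: bm_integrable. Qed.

Lemma exp_cst c : \int[P]_x c = c.
Proof.
transitivity (c * fine (P setT)); last by rewrite probability_setT mulr1.
exact: Rintegral_cst.
Qed.

Lemma exp_indic A : measurable A -> E \1_A = fine (P A).
Proof. by move=> mA; rewrite /Rintegral integral_indic// setIT. Qed.

Lemma exp_mono f g : bm f -> bm g -> (forall x, f x <= g x) -> E f <= E g.
Proof. by move=> bf bg fg; apply: le_Rintegral => //; exact: bm_integrable. Qed.

Definition Cov f g := \int[P]_x (f x * g x) - E f * E g.

Lemma covC f g : Cov f g = Cov g f.
Proof.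
by rewrite /Cov [E g * _]mulrC; under eq_Rintegral do rewrite mulrC.
Qed.

Lemma covDr f g h : bm f -> bm g -> bm h ->
  Cov f (fun x => g x + h x) = Cov f g + Cov f h.
Proof.
move=> bf bg bh; rewrite /Cov; under eq_Rintegral do rewrite mulrDr.
by rewrite !expD//; [ring|exact: bmM..].
Qed.

Lemma covZr c f g : bm f -> bm g -> Cov f (fun x => c * g x) = c * Cov f g.
Proof.
move=> bf bg; rewrite /Cov; under eq_Rintegral do rewrite mulrCA.
by rewrite !expZ//; [ring|exact: bmM].
Qed.

Lemma covDl f g h : bm f -> bm g -> bm h ->
  Cov (fun x => f x + g x) h = Cov f h + Cov g h.
Proof. by move=> bf bg bh; rewrite ![Cov _ h]covC covDr. Qed.

Lemma covZl c f g : bm f -> bm g -> Cov (fun x => c * f x) g = c * Cov f g.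
Proof. by move=> bf bg; rewrite ![Cov _ g]covC covZr. Qed.

Lemma cov0r f : bm f -> Cov f (fun=> 0) = 0.
Proof.
move=> bf; under [X in Cov _ X]funext do rewrite -(mul0r 0).
by rewrite covZr ?mul0r//; exact: bm_cst.
Qed.

Lemma cov_sumr I (r : seq I) (F : I -> T -> R) f :
  bm f -> (forall i, bm (F i)) ->
  Cov f (fun x => \sum_(i <- r) F i x) = \sum_(i <- r) Cov f (F i).
Proof.
move=> bf bF; elim: r => [|i r IHr].
  by under [X in Cov _ X]funext do rewrite big_nil; rewrite big_nil cov0r.
under [X in Cov _ X]funext do rewrite big_cons.
by rewrite big_cons covDr ?IHr//; exact: bm_sum.
Qed.

Lemma cov_suml I (r : seq I) (F : I -> T -> R) f :
  bm f -> (forall i, bm (F i)) ->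
  Cov (fun x => \sum_(i <- r) F i x) f = \sum_(i <- r) Cov (F i) f.
Proof.
by move=> bf bF; rewrite covC cov_sumr//; apply: eq_bigr => i _; exact: covC.
Qed.

Lemma cov_le_sqr f : Cov f f <= \int[P]_x (f x * f x).
Proof. by rewrite /Cov gerBl -expr2 sqr_ge0. Qed.

(** The variance is the integral of the square of the centred variable. *)
Lemma cov_ge0 f : bm f -> 0 <= Cov f f.
Proof.
move=> bf; pose m := E f.
have : 0 <= \int[P]_x ((f x - m) * (f x - m)).
  by apply: Rintegral_ge0 => x _; rewrite -expr2 sqr_ge0.
under eq_Rintegral => x _.
  rewrite (_ : _ * _ = f x * f x + ((- 2 * m) * f x + m * m)); last by ring.
  over.
have bff : bm (fun x => f x * f x) by exact: bmM.
have bmf : bm (fun x => (- 2 * m) * f x) by exact: bmZ.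
rewrite !expD ?expZ ?exp_cst//; try exact: bm_cst; last first.
  by apply: bmD => //; exact: bm_cst.
by rewrite /Cov -/m; congr (_ <= _); ring.
Qed.

Lemma covDD f g : bm f -> bm g ->
  Cov (fun x => f x + g x) (fun x => f x + g x)
  = Cov f f + 2 * Cov f g + Cov g g.
Proof.
move=> bf bg; have bfg := bmD bf bg.
by rewrite covDl// !covDr// [Cov g f]covC; ring.
Qed.

(** The variance of f + t g is a nonnegative quadratic polynomial in t. *)
Lemma cov_CauchySchwarz f g : bm f -> bm g ->
  Cov f g ^+ 2 <= Cov f f * Cov g g.
Proof.
move=> bf bg.
have quad t : 0 <= Cov f f + 2 * (t * Cov f g) + t * (t * Cov g g).
  have btg := bmZ t bg.
  by have := cov_ge0 (bmD bf btg); rewrite covDD// !covZr// covZl.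
have [g0|g0] := eqVneq (Cov g g) 0.
  have [->|fg0] := eqVneq (Cov f g) 0; first by rewrite g0 mulr0 expr0n.
  (* The polynomial is then affine in t; at this t it equals -1. *)
  have := quad (- (1 + Cov f f) / (2 * Cov f g)).
  rewrite g0 !mulr0 addr0 (_ : _ + _ = -1); last by field.
  by rewrite ler0N1.
have gp : 0 < Cov g g by rewrite lt_neqAle eq_sym g0 cov_ge0.
(* The minimum of the polynomial. *)
have := quad (- Cov f g / Cov g g).
rewrite (_ : _ + _ + _ = Cov f f - Cov f g ^+ 2 / Cov g g); last by field.
by rewrite subr_ge0 ler_pdivrMr.
Qed.

(** Young's form of the Cauchy-Schwarz inequality: it is linear in the variances,
    so that no square root is needed in the approximation argument. *)
Lemma cov_Young e f g : 0 < e -> bm f -> bm g ->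
  2 * `|Cov f g| <= e * Cov f f + e^-1 * Cov g g.
Proof.
move=> e0 bf bg.
have step s : `|s| = 1 -> 0 <= e * Cov f f + e^-1 * Cov g g + 2 * (s * Cov f g).
  move=> s1; have bsg := bmZ (s / e) bg.
  have ss : s * s = 1 by rewrite -expr2 -[s ^+ 2]real_normK ?num_real// s1 expr1n.
  have := cov_ge0 (bmD bf bsg); rewrite covDD// !covZr// covZl//.
  rewrite -(pmulr_rge0 _ e0); congr (_ <= _).
  have -> : s / e * (s / e * Cov g g) = (s * s) * (e^-1 * e^-1 * Cov g g) by ring.
  by rewrite ss mul1r; field; rewrite gt_eqF.
have := step 1 (normr1 _); have := step (-1) (normrN1 _).
by case: (ger0P (Cov f g)) => _; lra.
Qed.

End Covariance.

(** * Boxes in a product space *)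

Section Boxes.
Context (I : choiceType) d (T : measurableType d).
Implicit Types (s : seq I) (A : I -> set T).

Definition box s A : set (power_space I T) :=
  [set x | forall i, i \in s -> A i (x i)].

Definition boxes : set (set (power_space I T)) :=
  [set B | exists s A, (forall i, measurable (A i)) /\ B = box s A].

Lemma measurable_coordinate i :
  measurable_fun setT (coordinate i : power_space I T -> T).
Proof.
move=> _ A mA; rewrite setTI; apply: sub_sigma_algebra.
by exists i => //; exists A => //; rewrite setTI.
Qed.

Lemma measurable_box s A : (forall i, measurable (A i)) -> measurable (box s A).
Proof.
move=> mA; elim: s => [|i s IHs].
  by rewrite (_ : box _ _ = setT)//; apply/seteqP; split.
rewrite (_ : box _ _ = (coordinate i @^-1` A i) `&` box s A).
  by apply: measurableI => //; rewrite -[_ @^-1` _]setTI;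
     exact: measurable_coordinate.
apply/seteqP; split=> [x Bx|x [xi Bx] j].
  by split=> [|j js]; apply: Bx; rewrite inE ?eqxx// js orbT.
by rewrite inE => /orP[/eqP ->|/Bx].
Qed.

(** Allowing repeated indices and arbitrary factors outside s makes boxes stable
    under intersection: each family is padded with the whole space outside its
    own index set. *)
Lemma box_setI s t A B :
  box s A `&` box t B =
  box (s ++ t) (fun i => (if i \in s then A i else setT) `&`
                         (if i \in t then B i else setT)).
Proof.
apply/seteqP; split=> [x [Ax Bx] i _|x ABx].
  by split; case: ifPn => // /[dup] ? ; [move/Ax|move/Bx].
by split=> i ist; have := ABx i; rewrite mem_cat ist ?orbT => -[].
Qed.

Lemma box_undup s A : box s A = box (undup s) A.
Proof.
by apply/seteqP; split=> x Bx i si; apply: Bx; move: si; rewrite mem_undup.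
Qed.

Lemma boxes_setI_closed : setI_closed boxes.
Proof.
move=> _ _ [s [A [mA ->]]] [t [B [mB ->]]]; rewrite box_setI.
eexists; eexists; split; last by [].
by move=> i; apply: measurableI; case: ifP.
Qed.

(** Boxes form a pi-system generating the product sigma-algebra, which is what
    the two pi-lambda arguments below need. *)
Lemma measurable_boxesE : @measurable _ (power_space I T) = <<s boxes >>.
Proof.
apply/seteqP; split.
  apply: sub_sigma_algebra2 => _ [i _ [A mA <-]].
  exists [:: i], (fun=> A); split=> //.
  apply/seteqP; split=> [x [_ xA] j|x xA]; last by split => //; apply: xA; rewrite inE.
  by rewrite inE => /eqP ->.
apply: smallest_sub; first exact: sigma_algebra_measurable.
by move=> _ [s [A [mA ->]]]; exact: measurable_box.
Qed.

Context (R : realType) (nu : probability T R).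
Variable mu : probability (power_space I T) R.
Hypothesis mu_power : is_power_measure nu mu.

Lemma power_measure_box s A : uniq s -> (forall i, measurable (A i)) ->
  mu (box s A) = (\prod_(i <- s) nu (A i))%E.
Proof.
move=> us mA; case: s us => [|i0 s'] us.
  by rewrite big_nil (_ : box _ _ = setT) ?probability_setT//; apply/seteqP; split.
set s := i0 :: s' in us *.
rewrite (big_nth i0) big_mkord.
rewrite -(@mu_power _ (fun k : 'I_(size s) => nth i0 s k) (fun k => A (nth i0 s k)))//.
  congr (mu _); apply/seteqP; split=> x /= Bx.
    by move=> k; apply: Bx; exact: mem_nth.
  move=> i si; have := Bx (Ordinal (etrans (index_mem i s) si)).
  by rewrite /= nth_index.
by move=> j k /eqP; rewrite nth_uniq// => /eqP/val_inj.
Qed.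

(** Independence of coordinates: after padding, the product over the
    concatenated index list splits into the two products. *)
Lemma power_measure_box_indep s t A B :
  (forall i, measurable (A i)) -> (forall i, measurable (B i)) ->
  {in s, forall i, i \notin t} ->
  mu (box s A `&` box t B) = (mu (box s A) * mu (box t B))%E.
Proof.
move=> mA mB st.
rewrite (box_undup s) (box_undup t) box_setI !power_measure_box ?undup_uniq//.
- rewrite big_cat /=; congr (_ * _)%E; rewrite big_seq [RHS]big_seq.
    apply: eq_bigr => i; rewrite !mem_undup => si.
    by rewrite si (negbTE (st i si)) setIT.
  apply: eq_bigr => i; rewrite !mem_undup => ti; rewrite ti.
  by case: ifPn => [/st|_]; rewrite ?ti ?setTI.
- rewrite cat_uniq !undup_uniq andbT /=; apply/hasPn => i; rewrite !mem_undup.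
  by apply: contraTN => /st.
- by move=> i; apply: measurableI; case: ifP.
Qed.

End Boxes.

(** * From growth of moments to a norm bound *)

Lemma bernoulli_le (R : realType) (s : R) n : 1 <= s -> 1 + n%:R * (s - 1) <= s ^+ n.
Proof.
move=> s1; elim: n => [|n IHn]; first by rewrite mul0r addr0 expr0.
have : 1 + n.+1%:R * (s - 1) <= s * (1 + n%:R * (s - 1)).
  rewrite -[n.+1]addn1 natrD -subr_ge0.
  rewrite (_ : _ - _ = n%:R * (s - 1) ^+ 2); last by ring.
  by rewrite mulr_ge0// sqr_ge0.
by move=> /le_trans; apply; rewrite exprS ler_wpM2l// (le_trans _ s1).
Qed.

(** The spectral radius argument for a self-adjoint operator A, stated for the
    moments q n = <f, A^n f>. Iterating q n ^ 2 <= q 0 * q (2 n) gives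
    (|q 1| / q 0)^n <= |q n| / q 0 along n = 2^j; if |q 1| exceeded r q 0, the
    left-hand side would outgrow every multiple of r^n. *)
Lemma moment_growth_bound (R : realType) (q : nat -> R) (r C : R) :
  0 < r -> 0 <= q 0%N -> (forall n, q n ^+ 2 <= q 0%N * q (n + n)%N) ->
  (forall n, `|q n| <= C * r ^+ n) -> `|q 1%N| <= r * q 0%N.
Proof.
move=> r0 q0 qq qC.
have [q00|q0N] := eqVneq (q 0%N) 0.
  have := qq 1%N; rewrite q00 mul0r mulr0 => q1.
  by rewrite normr_le0 -sqrf_eq0 eq_le q1 sqr_ge0.
have qp : 0 < q 0%N by rewrite lt_neqAle eq_sym q0N.
rewrite leNgt; apply/negP => lt_q1.
pose s := `|q 1%N| / (r * q 0%N).
have s1 : 1 < s by rewrite ltr_pdivlMr ?mul1r// mulr_gt0.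
have q1E : `|q 1%N| = q 0%N * (s * r).
  by rewrite /s; field; rewrite q0N gt_eqF.
have grow j : q 0%N * (s * r) ^+ (2 ^ j) <= `|q (2 ^ j)%N|.
  elim: j => [|j IHj]; first by rewrite expn0 expr1 q1E.
  have := qq (2 ^ j)%N; rewrite addnn -mul2n -expnS => qqj.
  have sr0 : 0 <= s * r by rewrite mulr_ge0// ?ltW// (lt_trans _ s1).
  have : (q 0%N * (s * r) ^+ (2 ^ j)) ^+ 2 <= `|q (2 ^ j)%N| ^+ 2.
    by rewrite lerXn2r// nnegrE// mulr_ge0// exprn_ge0.
  rewrite real_normK ?num_real// => /le_trans/(_ qqj).
  rewrite exprMn -exprM -expnSr expr2 -mulrA ler_pM2l//.
  by move=> /le_trans; apply; exact: ler_norm.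
have sC j : s ^+ (2 ^ j) <= C / q 0%N.
  rewrite ler_pdivlMr// mulrC -(ler_pM2r (exprn_gt0 (2 ^ j) r0)) -mulrA -exprMn.
  exact: le_trans (grow j) (qC _).
have [j Cj] : exists j, C / q 0%N < j%:R * (s - 1).
  exists (Num.truncn (C / q 0%N / (s - 1))).+1.
  by rewrite -ltr_pdivrMr ?subr_gt0// truncnS_gt.
have := sC j; apply/negP; rewrite -ltNge; apply: (lt_le_trans Cj).
apply: le_trans (bernoulli_le (2 ^ j) (ltW s1)).
apply: ler_wpDl => //; apply: ler_wpM2r; first by rewrite subr_ge0 ltW.
by rewrite ler_nat ltnW// ltn_expl.
Qed.

(** * The Bernoulli shift *)

Section BernoulliShift.
Context (G : groupType) d (T : measurableType d) (R : realType).
Variables (nu : probability T R) (mu : probability (power_space G T) R).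
Hypothesis mu_power : is_power_measure nu mu.

Local Notation X := (power_space G T).
Local Notation bm := (@bounded_measurable _ X R).
Local Notation cov := (Cov mu).
Implicit Types (f g h k : X -> R) (c : G).

(** [translate], with the sigma-algebra of the product space on both sides. *)
Definition shift c (x : X) : X := translate c x.

Lemma shift_mul c c' x : shift c (shift c' x) = shift (c * c')%g x.
Proof. by apply/funext => i; rewrite /shift /translate mulgA. Qed.

Lemma shift1 x : shift 1%g x = x.
Proof. by apply/funext => i; rewrite /shift /translate mulg1. Qed.

Lemma preimage_shift_box c (s : seq G) (A : G -> set T) :
  shift c @^-1` box s A =
  box [seq (i * c)%g | i <- s] (fun i => A (i * c^-1)%g).
Proof.
apply/seteqP; split=> [x sx _ /mapP[i si ->]|x sx i si].
  by rewrite mulgK; exact: sx.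
by have := sx (i * c)%g (map_f _ si); rewrite mulgK.
Qed.

Lemma measurable_shift c : measurable_fun setT (shift c).
Proof.
apply: (measurability (@boxes G d T)); first exact: measurable_boxesE.
move=> _ [_ [s [A [mA ->]]] <-]; rewrite setTI preimage_shift_box.
exact: measurable_box.
Qed.

Lemma measurable_preimage_shift c (A : set X) :
  measurable A -> measurable (shift c @^-1` A).
Proof. by move=> mA; rewrite -[_ @^-1` _]setTI; exact: measurable_shift. Qed.

(** Translating the indices of a box does not change its measure, and boxes
    determine the measure by the pi-lambda theorem. *)
Lemma shift_preserves_measure c (A : set X) :
  measurable A -> mu (shift c @^-1` A) = mu A.
Proof.
rewrite {1}measurable_boxesE.
apply: (dynkin_induction (P := fun A => mu (shift c @^-1` A) = mu A)).
- exact: measurable_boxesE.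
- exact: boxes_setI_closed.
- by rewrite preimage_setT.
- move=> _ [s [B [mB ->]]].
  rewrite box_undup preimage_shift_box !(power_measure_box mu_power) ?undup_uniq//.
    by rewrite big_map; apply: eq_bigr => i _; rewrite mulgK.
  by rewrite map_inj_uniq ?undup_uniq//; exact: mulIg.
- move=> S mS muS; rewrite preimage_setC !probability_setC ?muS//.
  exact: measurable_preimage_shift.
- move=> F mF tF muF; rewrite preimage_bigcup !measure_bigcup//.
  + by apply: eq_eseriesr => n _; exact: muF.
  + by move=> n _; exact: measurable_preimage_shift.
  + apply/trivIsetP => i j _ _ ij; rewrite -preimage_setI.
    by move/trivIsetP : tF => -> //; rewrite preimage_set0.
Qed.

Lemma bm_shift c f : bm f -> bm (fun x => f (shift c x)).
Proof.
move=> [mf [M fM]]; split; last by exists M.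
by apply: (measurableT_comp mf); exact: measurable_shift.
Qed.

Lemma exp_shift c f : bm f -> \int[mu]_x f (shift c x) = \int[mu]_x f x.
Proof.
move=> bf; rewrite /Rintegral; congr fine.
rewrite -(@integral_pushforward _ _ _ _ R _ (measurable_shift c) mu setT (EFin \o f))//.
- apply: eq_measure_integral => [|ms A mA _]; first exact: measurable_shift.
  exact: shift_preserves_measure.
- by apply/measurable_EFinP; exact: bf.1.
- by rewrite preimage_setT; exact: bm_integrable (bm_shift c bf).
Qed.

Lemma cov_shift c f g : bm f -> bm g ->
  cov (fun x => f (shift c x)) (fun x => g (shift c x)) = cov f g.
Proof.
move=> bf bg; rewrite /Cov.
by rewrite !exp_shift// (exp_shift c (bmM bf bg)).
Qed.

(** * Decay of correlations and the gap for cylindrical functions *)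

(** The linear span of the indicators of boxes. As an inductive predicate it lets
    bilinear facts be checked on pairs of boxes only. *)
Inductive cylindrical : (X -> R) -> Prop :=
| cylindrical_box B : boxes B -> cylindrical \1_B
| cylindricalD f g : cylindrical f -> cylindrical g ->
    cylindrical (fun x => f x + g x)
| cylindricalZ a f : cylindrical f -> cylindrical (fun x => a * f x).

Lemma boxes_measurable (B : set X) : boxes B -> measurable B.
Proof. by move=> [s [A [mA ->]]]; exact: measurable_box. Qed.

Lemma cylindrical_bm f : cylindrical f -> bm f.
Proof.
elim=> {f} [B /boxes_measurable|f g _ bf _ bg|a f _ bf].
- exact: bm_indic.
- exact: bmD.
- exact: bmZ.
Qed.

Section Decay.
Variable W : G -> R.
Hypothesis W_gt0 : forall c, 0 < W c.

Lemma indic_shift (B : set X) c :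
  (fun x => \1_B (shift c x)) = \1_(shift c @^-1` B) :> (X -> R).
Proof. by apply/funext => x; rewrite !indicE. Qed.

(** A box and the c-translate of another one are independent unless c is one of
    the finitely many quotients of an index of the first by an index of the
    second; the constant C only has to take care of these. *)
Lemma cov_boxes_decay (B B' : set X) : boxes B -> boxes B' ->
  exists C, forall c, `|cov \1_B (fun x => \1_B' (shift c x))| <= C * W c.
Proof.
move=> bB bB'; have mB := boxes_measurable bB; have mB' := boxes_measurable bB'.
case: bB bB' => [s [A [mA BE]]] [t [A' [mA' B'E]]].
(* Each of the finitely many exceptional c contributes 1 / W c to the constant. *)
pose w := \sum_(i <- s) \sum_(j <- t) (W (j^-1 * i)%g)^-1.
exists w => c.
have covE : cov \1_B (fun x => \1_B' (shift c x)) =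
    fine (mu (B `&` shift c @^-1` B')) - fine (mu B) * fine (mu (shift c @^-1` B')).
  have mcB' := measurable_preimage_shift c mB'.
  rewrite indic_shift /Cov !exp_indic//; congr (_ - _).
  rewrite -exp_indic; last exact: measurableI.
  by apply: eq_Rintegral => x _; rewrite indicI.
have [/hasP[i si /hasP[j tj /eqP ij]]|nst] :=
  boolP (has (fun i => has (fun j => i == j * c)%g t) s); last first.
  rewrite covE {1}B'E {1}BE preimage_shift_box (power_measure_box_indep mu_power)//.
    rewrite -BE -preimage_shift_box -B'E fineM ?fin_num_measure//.
      by rewrite subrr normr0; apply: mulr_ge0 (ltW (W_gt0 c));
         apply: sumr_ge0 => i _; apply: sumr_ge0 => j _; rewrite invr_ge0 ltW.
    exact: measurable_preimage_shift.
  move=> i si; apply/negP => /mapP[j tj ij].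
  by move/hasP: nst; apply; exists i => //; apply/hasP; exists j => //; apply/eqP.
have cE : c = (j^-1 * i)%g by rewrite ij mulKg.
apply: (@le_trans _ _ 1).
  have le01 (D : set X) : measurable D -> 0 <= fine (mu D) <= 1.
    move=> mD; rewrite fine_ge0//= -lee_fin fineK ?fin_num_measure//.
    exact: probability_le1.
  have mcB' := measurable_preimage_shift c mB'.
  have := le01 _ (measurableI _ _ mB mcB'); have := le01 _ mB; have := le01 _ mcB'.
  rewrite covE; set u := fine (mu B); set v := fine _; set z := fine (mu (_ `&` _)).
  move=> /andP[v0 v1] /andP[u0 u1] /andP[z0 z1].
  have uv0 : 0 <= u * v by rewrite mulr_ge0.
  have uv1 : u * v <= 1 by rewrite mulr_ile1.
  by rewrite ler_norml; apply/andP; split; lra.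
rewrite -ler_pdivrMr// mul1r /w.
rewrite (big_rem i si)/= (big_rem j tj)/= -cE -addrA lerDl addr_ge0//.
  by apply: sumr_ge0 => k _; rewrite invr_ge0 ltW.
by apply: sumr_ge0 => k _; apply: sumr_ge0 => l _; rewrite invr_ge0 ltW.
Qed.

Lemma cov_cylindrical_decay f g : cylindrical f -> cylindrical g ->
  exists C, forall c, `|cov f (fun x => g (shift c x))| <= C * W c.
Proof.
move=> cf; elim=> {g} [B' bB'|g h cg [Cg Cgle] ch [Ch Chle]|a g cg [C Cle]].
- elim: cf => {f} [B bB|f h cf [Cf Cfle] ch [Ch Chle]|a f cf [C Cle]].
  + exact: cov_boxes_decay.
  + exists (Cf + Ch) => c; rewrite covDl ?mulrDl; last 3 first.
    * exact: cylindrical_bm.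
    * exact: cylindrical_bm.
    * by apply/bm_shift/bm_indic; exact: boxes_measurable.
    exact: le_trans (ler_normD _ _) (lerD (Cfle c) (Chle c)).
  + exists (`|a| * C) => c; rewrite covZl ?normrM -?mulrA ?ler_wpM2l//.
      exact: cylindrical_bm.
    by apply/bm_shift/bm_indic; exact: boxes_measurable.
- exists (Cg + Ch) => c; rewrite covDr ?mulrDl; last 3 first.
  + exact: cylindrical_bm.
  + exact/bm_shift/cylindrical_bm.
  + exact/bm_shift/cylindrical_bm.
  exact: le_trans (ler_normD _ _) (lerD (Cgle c) (Chle c)).
- exists (`|a| * C) => c; rewrite covZr ?normrM -?mulrA ?ler_wpM2l//.
    exact: cylindrical_bm.
  exact/bm_shift/cylindrical_bm.
Qed.

(** W is a positive r-superharmonic function for the random walk driven by the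
    involutions a i; by Kesten's criterion such a W with r < #|J| witnesses
    nonamenability. *)
Section Averaging.
Context (J : finType) (a : J -> G) (r : R).
Hypothesis aK : forall i, (a i * a i)%g = 1%g.
Hypothesis r_gt0 : 0 < r.
Hypothesis W_super : forall c, \sum_i W (a i * c)%g <= r * W c.

Definition adjacency f : X -> R := fun x => \sum_i f (shift (a i) x).

Lemma bm_adjacency f : bm f -> bm (adjacency f).
Proof. by move=> bf; apply: bm_sum => i; exact: bm_shift. Qed.

Lemma bm_iter_adjacency n f : bm f -> bm (iter n adjacency f).
Proof. by move=> bf; elim: n => //= n; exact: bm_adjacency. Qed.

(** Self-adjointness: the a i are involutions acting by measure-preserving maps. *)
Lemma cov_adjacencyC f g : bm f -> bm g ->
  cov (adjacency f) g = cov f (adjacency g).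
Proof.
move=> bf bg; rewrite /adjacency cov_suml ?cov_sumr//; last 2 first.
- by move=> i; exact: bm_shift.
- by move=> i; exact: bm_shift.
apply: eq_bigr => i _; rewrite -(cov_shift (a i))//; last exact: bm_shift.
by congr (cov _ _); apply/funext => x; rewrite shift_mul aK shift1.
Qed.

Lemma cov_iter_adjacencyC n f g : bm f -> bm g ->
  cov (iter n adjacency f) g = cov f (iter n adjacency g).
Proof.
elim: n f g => // n IHn f g bf bg.
by rewrite iterS cov_adjacencyC ?IHn -?iterSr//;
  [exact: bm_adjacency|exact: bm_iter_adjacency].
Qed.

(** The correlation of f with the iterates of g evolves under the random walk, so
    superharmonicity of W propagates the bound at the cost of a factor r. *)
Lemma cov_iter_decay C f g : bm f -> bm g ->
  (forall c, `|cov f (fun x => g (shift c x))| <= C * W c) ->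
  forall n c, `|cov f (fun x => iter n adjacency g (shift c x))| <= C * r ^+ n * W c.
Proof.
move=> bf bg gC; elim=> [|n IHn] c; first by rewrite expr0 mulr1; exact: gC.
have C0 : 0 <= C.
  by rewrite -(pmulr_lge0 _ (W_gt0 1%g)); apply: le_trans (gC 1%g).
rewrite /= /adjacency; under [X in cov _ X]funext => x do
  under eq_bigr do rewrite shift_mul.
rewrite cov_sumr//; last by move=> i; exact/bm_shift/bm_iter_adjacency.
apply: le_trans (ler_norm_sum _ _ _) _.
apply: le_trans (ler_sum _ (fun i _ => IHn (a i * c)%g)) _.
by rewrite -mulr_sumr exprSr mulrA -mulrA ler_wpM2l// mulr_ge0// exprn_ge0// ltW.
Qed.

Lemma cylindrical_gap f : cylindrical f ->
  `|cov f (adjacency f)| <= r * cov f f.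
Proof.
move=> cf; have bf := cylindrical_bm cf.
have [C fC] := cov_cylindrical_decay cf cf.
apply: (@moment_growth_bound _ (fun n => cov f (iter n adjacency f)) r (C * W 1%g)) => //.
- exact: cov_ge0.
- move=> n; rewrite iterD -[cov f (iter n _ (iter _ _ _))]cov_iter_adjacencyC//;
    last exact: bm_iter_adjacency.
  exact: cov_CauchySchwarz (bm_iter_adjacency _ bf).
- move=> n; have := cov_iter_decay bf bf fC n 1%g.
  rewrite mulrAC; congr (`|Cov _ _ _| <= _).
  by apply/funext => x; rewrite shift1.
Qed.

End Averaging.
End Decay.

(** * The spectral gap for functions approximable in mean square *)

Definition approximable f := bm f /\ forall e, 0 < e ->
  exists2 k, cylindrical k & \int[mu]_x ((f x - k x) * (f x - k x)) <= e.

Lemma exp_sqrD_le f g : bm f -> bm g ->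
  \int[mu]_x ((f x + g x) * (f x + g x)) <=
  2 * (\int[mu]_x (f x * f x) + \int[mu]_x (g x * g x)).
Proof.
move=> bf bg; have bff := bmM bf bf; have bgg := bmM bg bg.
rewrite -expD// -expZ; last exact: bmD.
apply: exp_mono => [||x]; [by apply: bmM; apply: bmD|by apply/bmZ/bmD|].
rewrite -subr_ge0 (_ : _ - _ = (f x - g x) ^+ 2) ?sqr_ge0//.
by ring.
Qed.

Lemma approximable_lim f : bm f ->
  (forall e, 0 < e -> exists2 g, approximable g &
     \int[mu]_x ((f x - g x) * (f x - g x)) <= e) -> approximable f.
Proof.
move=> bf fg; split=> // e e0; have e4 : 0 < e / 4 by lra.
have [g [bg gk] fge] := fg _ e4; have [k ck gke] := gk _ e4.
exists k => //; have bk := cylindrical_bm ck.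
have := exp_sqrD_le (bmB bf bg) (bmB bg bk).
under eq_Rintegral => x _ do
  [have -> : f x - g x + (g x - k x) = f x - k x by ring].
by move=> /le_trans; apply; lra.
Qed.

Lemma approximableD f g : approximable f -> approximable g ->
  approximable (fun x => f x + g x).
Proof.
move=> [bf fa] [bg ga]; split; first exact: bmD.
move=> e e0; have e4 : 0 < e / 4 by lra.
have [k ck fk] := fa _ e4; have [l cl gl] := ga _ e4.
exists (fun x => k x + l x); first exact: cylindricalD.
have := exp_sqrD_le (bmB bf (cylindrical_bm ck)) (bmB bg (cylindrical_bm cl)).
under eq_Rintegral => x _ do
  [have -> : f x - k x + (g x - l x) = f x + g x - (k x + l x) by ring].
by move=> /le_trans; apply; lra.
Qed.

Lemma approximableN f : approximable f -> approximable (fun x => -1 * f x).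
Proof.
move=> [bf fa]; split=> [|e /fa[k ck fk]]; first exact: bmZ.
exists (fun x => -1 * k x); first exact: cylindricalZ.
under eq_Rintegral => x _ do
  [have -> : (-1 * f x - -1 * k x) * (-1 * f x - -1 * k x) =
             (f x - k x) * (f x - k x) by ring].
by [].
Qed.

Lemma cylindrical_approximable f : cylindrical f -> approximable f.
Proof.
move=> cf; split=> [|e e0]; first exact: cylindrical_bm.
exists f => //; under eq_Rintegral => x _ do rewrite subrr mulr0.
by rewrite exp_cst ltW.
Qed.

Lemma approximable_cst1 : approximable (fun=> 1).
Proof.
apply: cylindrical_approximable.
rewrite (_ : (fun=> 1) = \1_(box [::] (fun=> setT) : set X)).
  by apply: cylindrical_box; exists [::], (fun=> setT).
by apply/funext => x; rewrite indicE mem_set.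
Qed.

(** The pi-lambda theorem applies because approximability is stable under linear
    combinations, hence under complements and finite disjoint unions, and under
    limits in mean square, hence under countable disjoint unions. *)
Lemma approximable_indic (A : set X) : measurable A -> approximable \1_A.
Proof.
rewrite {1}measurable_boxesE.
apply: (dynkin_induction (P := fun A => approximable \1_A)).
- exact: measurable_boxesE.
- exact: boxes_setI_closed.
- by rewrite indicT; exact: approximable_cst1.
- by move=> B bB; exact/cylindrical_approximable/cylindrical_box.
- move=> S mS aS.
  rewrite (_ : \1_(~` S) = fun x : X => 1 + -1 * \1_S x).
    exact: approximableD approximable_cst1 (approximableN aS).
  by apply/funext => x; rewrite indicC indicE; case: (_ \in _) => /=; lra.
- move=> F mF tF aF; have mUF : measurable (\bigcup_k F k) by exact: bigcup_measurable.
  pose U n := \big[setU/set0]_(i < n) F i.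
  have mU n : measurable (U n) by exact: bigsetU_measurable.
  have aU n : approximable \1_(U n).
    elim: n => [|n IHn].
      rewrite /U big_ord0 indic0 (_ : cst 0 = fun x : X => 1 + -1 * 1).
        exact: approximableD approximable_cst1 (approximableN approximable_cst1).
      by apply/funext => x; rewrite /=; lra.
    rewrite (_ : \1_(U n.+1) = fun x => \1_(U n) x + \1_(F n) x).
      exact: approximableD.
    apply/funext => x; rewrite /U big_ord_recr /= !indicE in_setU.
    case: (boolP (x \in F n)) => Fnx; last by rewrite orbF addr0.
    rewrite orbT (_ : (x \in _) = false) ?add0r//; apply/negP.
    rewrite inE -bigcup_mkord => -[i /= ltin Fix].
    have FFx : (F i `&` F n) !=set0 by exists x; split => //; rewrite inE in Fnx.
    by move: ltin; rewrite (tF i n I I FFx) ltnn.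
  have UF : \bigcup_n U n = \bigcup_k F k.
    apply/seteqP; split=> [x [n _]|x [k _ Fkx]]; first exact: bigsetU_bigcup.
    by exists k.+1 => //; rewrite /U -bigcup_mkord; exists k => /=.
  apply: approximable_lim => [|e e0]; first exact: bm_indic.
  have : (fine \o (mu \o U)) n @[n --> \oo] --> fine (mu (\bigcup_k F k)).
    apply: fine_cvg; rewrite fineK ?fin_num_measure// -UF.
    apply: nondecreasing_cvg_mu => //; first by rewrite UF.
    move=> n m nm; apply/subsetPset; rewrite /U -!bigcup_mkord => x [i /= lti Fix].
    by exists i => //=; exact: leq_trans nm.
  move=> /cvgrPdist_le /(_ e e0)[N _ /(_ N (leqnn N))] /= UN.
  exists \1_(U N) => //; apply: le_trans UN; apply: le_trans (ler_norm _).
  have subU : U N `<=` \bigcup_k F k by exact: bigsetU_bigcup.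
  (* For nested sets the squared difference of indicators is the difference. *)
  under eq_Rintegral => x _.
    rewrite (_ : _ * _ = \1_(\bigcup_k F k) x + -1 * \1_(U N) x); last first.
      rewrite !indicE; case: (boolP (x \in U N)) => [|_]; last first.
        by case: (_ \in _) => /=; ring.
      by rewrite inE => /subU xF; rewrite mem_set//=; ring.
    over.
  have bU : bm \1_(U N) by exact: bm_indic.
  have bF : bm \1_(\bigcup_k F k) by exact: bm_indic.
  by rewrite expD ?expZ ?exp_indic ?mulN1r//; exact: bmZ.
Qed.

Section Gap.
Context (W : G -> R) (J : finType) (a : J -> G) (r : R).
Hypothesis W_gt0 : forall c, 0 < W c.
Hypothesis aK : forall i, (a i * a i)%g = 1%g.
Hypothesis r_gt0 : 0 < r.
Hypothesis W_super : forall c, \sum_i W (a i * c)%g <= r * W c.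

Local Notation adj := (adjacency a).

Lemma cov_adjacency_le f : bm f -> 2 * `|cov f (adj f)| <= 2 * #|J|%:R * cov f f.
Proof.
move=> bf; rewrite cov_sumr//; last by move=> i; exact: bm_shift.
have step i : 2 * `|cov f (fun x => f (shift (a i) x))| <= 2 * cov f f.
  have := cov_Young mu (@ltr01 R) bf (bm_shift (a i) bf).
  by rewrite cov_shift// invr1 !mul1r; lra.
apply: le_trans (ler_wpM2l _ (ler_norm_sum _ _ _)) _ => //.
rewrite mulr_sumr; apply: le_trans (ler_sum _ (fun i _ => step i)) _.
by rewrite sumr_const -[_ *+ #|_|]mulr_natr mulrAC.
Qed.

(** Spectral gap. Both sides are continuous in h for the mean square distance, and
    the inequality is known for cylindrical k. With f = h - k of second moment at
    most t^2, Young's inequality with parameter t bounds every cross term by a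
    multiple of t; K collects these multiples. *)
Theorem approximable_gap h : approximable h ->
  `|cov h (adj h)| <= r * cov h h.
Proof.
move=> [bh ha]; set v := cov h h; have v0 : 0 <= v by exact: cov_ge0.
have bAh : bm (adj h) by exact: bm_adjacency.
set u := cov (adj h) (adj h); have u0 : 0 <= u by exact: cov_ge0.
pose K := r * (v + 2) + u + 1 + #|J|%:R.
have K0 : 0 < K.
  have rv0 : 0 <= r * (v + 2) by apply: mulr_ge0; [exact: ltW|lra].
  have J0 : 0 <= #|J|%:R :> R by [].
  by rewrite /K; lra.
apply/ler_addgt0Pr => e e0.
pose t := Num.min 1 (e / K).
have t0 : 0 < t by rewrite lt_min ltr01 divr_gt0.
have t1 : t <= 1 by rewrite ge_min lexx.
have tK : t * K <= e by rewrite -ler_pdivlMr// ge_min lexx orbT.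
have [k ck hk] := ha _ (mulr_gt0 t0 t0); have bk := cylindrical_bm ck.
pose f x := h x - k x; have bf : bm f by exact: bmB.
have vf : cov f f <= t * t by exact: le_trans (cov_le_sqr _ _) hk.
have bNf : bm (fun x => -1 * f x) by exact: bmZ.
have kE : k = fun x => h x + -1 * f x by apply/funext => x; rewrite /f; ring.
have AkE : adj k = fun x => adj h x + -1 * adj f x.
  by apply/funext => x; rewrite /adjacency mulr_sumr -big_split kE.
have bAf : bm (adj f) by exact: bm_adjacency.
have bNAf : bm (fun x => -1 * adj f x) by exact: bmZ.
have := cylindrical_gap W_gt0 aK r_gt0 W_super ck.
have -> : cov k k = v - 2 * cov h f + cov f f.
  by rewrite {1 2}kE covDD// covZl// !covZr// /v; ring.
have -> : cov k (adj k) = cov h (adj h) - 2 * cov f (adj h) + cov f (adj f).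
  rewrite AkE {1}kE covDl//; last exact: bmD.
  rewrite !covDr// !covZr// !covZl// -(cov_adjacencyC aK bh bf).
  by rewrite (covC _ (adj h)); ring.
have tV : t^-1 * cov f f <= t by rewrite ler_pdivrMl.
have := cov_Young mu t0 bh bf; have := cov_Young mu t0 bAh bf.
rewrite (covC _ (adj h)) -/v -/u => Yu Yv.
have := cov_adjacency_le bf; have J0 : 0 <= #|J|%:R :> R by [].
have vf' : cov f f <= t by nra.
move=> Yf gap.
have q_le : `|cov f (adj f)| <= #|J|%:R * t.
  by have := ler_wpM2l J0 vf'; lra.
have h_le : 2 * `|cov h f| <= t * v + t by lra.
have p_le : 2 * `|cov f (adj h)| <= t * u + t by lra.
have X_le : `|cov h (adj h)| <=
    `|cov h (adj h) - 2 * cov f (adj h) + cov f (adj f)| +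
    2 * `|cov f (adj h)| + `|cov f (adj f)|.
  set p := cov f (adj h); set q := cov f (adj f).
  have -> : 2 * `|p| = `|2 * p| by rewrite normrM (@ger0_norm _ 2).
  have {1}-> : cov h (adj h) = cov h (adj h) - 2 * p + q + 2 * p - q by ring.
  by apply: le_trans (ler_normB _ _) _; rewrite lerD2r ler_normD.
have rh : r * (v - 2 * cov h f + cov f f) <= r * (v + (t * v + t) + t).
  rewrite ler_pM2l//; have := ler_norm (- cov h f); rewrite normrN; lra.
rewrite (le_trans X_le)// (le_trans (lerD (lerD gap p_le) q_le))//.
apply: (@le_trans _ _ (r * v + t * K)); last by rewrite lerD2l.
rewrite (le_trans (lerD (lerD rh (lexx _)) (lexx _)))// /K.
by rewrite le_eqVlt; apply/orP; left; apply/eqP; ring.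
Qed.

End Gap.

End BernoulliShift.

(** * A superharmonic weight on Delta *)

Section TreeWeight.
Variable R : realType.

(** The quotient of Delta by b is a free product of three groups of order 2. Its
    elements are the words without equal adjacent letters, on which a letter
    acts by multiplication on the left followed by cancellation. *)
Definition act_letter (l : letter Delta_letter) (s : seq 'I_3) : seq 'I_3 :=
  if l.1 is Some i then
    if s is j :: s' then if i == j then s' else i :: s else [:: i]
  else s.

Definition act_word (w : word Delta_letter) (s : seq 'I_3) : seq 'I_3 :=
  foldr act_letter s w.

Definition reduced : pred (seq 'I_3) := sorted [rel i j | i != j].

Lemma act_letter_reduced l s : reduced s -> reduced (act_letter l s).
Proof.
case: l => -[i|] b //; case: s => [|j s] //= js; rewrite /act_letter /=.
by case: eqVneq => [_|ij]; [exact: path_sorted js|rewrite /= ij].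
Qed.

Lemma act_word_reduced w s : reduced s -> reduced (act_word w s).
Proof. move=> rs; elim: w => //= l w; exact: act_letter_reduced. Qed.

Lemma act_letterK l l' s : l.1 = l'.1 -> reduced s ->
  act_letter l (act_letter l' s) = s.
Proof.
case: l l' => [p b] [q b'] /= <-; case: p => [i|] //.
rewrite /act_letter /=; case: s => [|j s] /=; first by rewrite eqxx.
case: eqVneq => [<-|_ _]; last by rewrite eqxx.
by case: s => [|k s] //= /andP[/negbTE -> _].
Qed.

(** The action on reduced words respects the relations, so that the reduced form
    below is well defined on the group without a normal form theorem. *)
Lemma act_word_pres_eq u v : pres_eq Delta_rels u v ->
  {in reduced, act_word u =1 act_word v}.
Proof.
elim=> {u v} [u s rs|u v _ uv s rs|u v w _ uv _ vw s rs|u v l s rs|u v r rr s rs].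
- by [].
- by rewrite uv.
- by rewrite uv// vw.
- rewrite /act_word !foldr_cat /= -/(act_word v s).
  by rewrite act_letterK//; exact: act_word_reduced.
- rewrite /act_word !foldr_cat; congr foldr; rewrite -/(act_word v s).
  have rv : reduced (act_word v s) by exact: act_word_reduced.
  by case: rr => [[i ->]|->//|[i ->]];
    exact: (@act_letterK (Some i, false) (Some i, false) _ erefl rv).
Qed.

Definition tree_word (c : Delta) : seq 'I_3 := act_word (pres_word c) [::].

Lemma tree_word_mul i (c : Delta) :
  tree_word (Delta_a i * c)%g = act_letter (Some i, false) (tree_word c).
Proof.
rewrite /tree_word -[RHS]/(act_word ((Some i, false) :: pres_word c) [::]).
apply: act_word_pres_eq => //; apply/pres_classP; rewrite pres_wordK.
by rewrite -[in LHS](pres_wordK c); exact: pres_mulE.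
Qed.

Definition tree_weight (c : Delta) : R := (2 / 3) ^+ size (tree_word c).

Lemma tree_weight_gt0 c : 0 < tree_weight c.
Proof. by rewrite exprn_gt0// divr_gt0. Qed.

(** Away from the root one neighbour is closer and two are farther, which gives
    the factor 3/2 + 2 * (2/3) = 17/6; at the root all three neighbours are
    farther, and 3 * (2/3) = 2 is smaller. *)
Lemma tree_weight_super c :
  \sum_i tree_weight (Delta_a i * c)%g <= 17 / 6 * tree_weight c.
Proof.
rewrite /tree_weight; under eq_bigr do rewrite tree_word_mul.
case: (tree_word c) => [|j s].
  under eq_bigr do rewrite /= expr1; rewrite sumr_const card_ord /=; lra.
rewrite (bigD1 j)//= /act_letter /= eqxx.
under eq_bigr => i ij do rewrite (negbTE ij) /=.
rewrite sumr_const cardC1 card_ord /= !exprS.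
by rewrite mulr2n le_eqVlt; apply/orP; left; apply/eqP; field.
Qed.

End TreeWeight.

(** * The relations of Delta *)

Section DeltaRelations.
Local Open Scope group_scope.
Let b := Delta_b.

Lemma Delta_aK i : Delta_a i * Delta_a i = 1 :> Delta.
Proof.
apply: etrans (pres_mulE _ _ _) _; apply/pres_classP.
apply: (pres_rel (rels := Delta_rels) [::] [::] (r := wa i ++ wa i)).
by constructor 1; exists i.
Qed.

Lemma Delta_b3 : b * (b * b) = 1.
Proof.
rewrite [b * b]pres_mulE; apply: etrans (pres_mulE _ _ _) _; apply/pres_classP.
apply: (pres_rel (rels := Delta_rels) [::] [::] (r := wb ++ wb ++ wb)).
by constructor 2.
Qed.

Lemma Delta_abab i : Delta_a i * (b * (Delta_a i * b)) = 1.
Proof.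
rewrite [Delta_a i * b]pres_mulE [b * _]pres_mulE.
apply: etrans (pres_mulE _ _ _) _; apply/pres_classP.
apply: (pres_rel (rels := Delta_rels) [::] [::] (r := wa i ++ wb ++ wa i ++ wb)).
by constructor 3; exists i.
Qed.

Lemma Delta_bV : b^-1 = b * b.
Proof. by apply: (mulgI b); rewrite mulgV Delta_b3. Qed.

Lemma Delta_ab i : Delta_a i * b = b * b * Delta_a i.
Proof.
rewrite -Delta_bV; apply: (mulgI b); rewrite mulVKg.
by apply: (mulgI (Delta_a i)); rewrite Delta_abab Delta_aK.
Qed.

Lemma Delta_abb i : Delta_a i * (b * b) = b * Delta_a i.
Proof.
by rewrite mulgA Delta_ab -mulgA Delta_ab mulgA -(mulgA b b (b * b)) Delta_b3 mulg1.
Qed.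

Lemma finite_Delta_F : finite_set Delta_F.
Proof.
rewrite finite_setU; split; last exact: finite_set1.
exact: finite_image.
Qed.

End DeltaRelations.

(** * Colourings of prisms *)

Definition cyclic3 (c0 c1 c2 : 'I_3) := (c1 == ordS c0) && (c2 == ordS c1).

Lemma cyclic3_rot c0 c1 c2 : cyclic3 c0 c1 c2 -> cyclic3 c1 c2 c0.
Proof.
by case: c0 c1 c2 => [[|[|[|?]]] ?] [[|[|[|?]]] ?] [[|[|[|?]]] ?].
Qed.

Lemma cyclic3N c0 c1 c2 : cyclic3 c0 c1 c2 -> cyclic3 c2 c1 c0 = false.
Proof.
by case: c0 c1 c2 => [[|[|[|?]]] ?] [[|[|[|?]]] ?] [[|[|[|?]]] ?].
Qed.

Lemma distinct_cyclic3 c0 c1 c2 : c0 != c1 -> c0 != c2 -> c1 != c2 ->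
  cyclic3 c0 c1 c2 || cyclic3 c2 c1 c0.
Proof.
by case: c0 c1 c2 => [[|[|[|?]]] ?] [[|[|[|?]]] ?] [[|[|[|?]]] ?].
Qed.

(** The c and the d are the colours of the triangles at x and at a_i x, each listed
    in the order of the powers of b; the matching joins c1 to d2 and c2 to d1
    because a_i b = b^2 a_i. *)
Lemma prism_cyclic3 (c0 c1 c2 d0 d1 d2 : 'I_3) :
  d0 != d1 -> d0 != d2 -> d1 != d2 ->
  c0 != d0 -> c1 != d2 -> c2 != d1 ->
  cyclic3 c0 c1 c2 -> cyclic3 d2 d1 d0.
Proof.
move=> d01 d02 d12 + + + /andP[/eqP c1E /eqP c2E]; rewrite c2E c1E.
move: d01 d02 d12; clear.
case: d0 d1 d2 => [[|[|[|?]]] ?] [[|[|[|?]]] ?] [[|[|[|?]]] ?] //;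
by case: c0 => [[|[|[|?]]] ?].
Qed.

(** * The orientation of the triangle at the identity *)

Section Colouring.
Variables (R : realType) (mu : probability (cube R Delta) R).
Hypothesis mu_power : is_power_measure (unit_lebesgue (R := R)) mu.
Variable f : cube R Delta -> labellings Delta.
Hypothesis f_fiid : fiid_labelling mu f.

Local Notation X := (power_space Delta (unit_itv R)).
Local Notation a := Delta_a.
Local Notation b := Delta_b.
Local Notation good := (properly_coloured_at1 Delta_F f).

Lemma measurable_colour (c : Delta) (K : set 'I_3) :
  measurable [set x : X | K (f x c)].
Proof.
have mc : measurable (coordinate c @^-1` K : set (labellings Delta)).
  by rewrite -[_ @^-1` _]setTI; exact: measurable_coordinate.
by have := f_fiid.1 measurableT _ mc; rewrite setTI.
Qed.

Lemma measurable_colour_rel (c c' : Delta) (K : rel 'I_3) :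
  measurable [set x : X | K (f x c) (f x c')].
Proof.
rewrite (_ : [set x | _] = \bigcup_(k in setT)
    ([set x : X | [set k] (f x c)] `&` [set x | [set l | K k l] (f x c')])).
  apply: fin_bigcup_measurable => [|k _]; first exact: finite_finset.
  by apply: measurableI; exact: measurable_colour.
apply/seteqP; split=> [x Kx|x [k _ [/= -> //]]].
by exists (f x c).
Qed.

Lemma measurable_good : measurable (good : set X).
Proof.
pose S := [set c : Delta | cayley_adj Delta_F 1%g c].
have -> : good = \bigcap_(c in S) [set x : X | f x 1%g != f x c].
  apply/seteqP; split=> [x gx c Sc|x gx c Sc]; first by apply/eqP; exact: gx.
  by apply/eqP; exact: gx.
apply: fin_bigcap_measurable => [|c _]; last first.
  exact: (measurable_colour_rel _ _ (fun k l => k != l)).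
apply: (@sub_finite_set _ _ (Delta_F `|` [set c^-1%g | c in Delta_F])).
  move=> c [c' Fc' ->]; rewrite mulg1; case: Fc' => [|Fc']; first by left.
  by right; exists c'^-1%g => //; rewrite invgK.
by rewrite finite_setU; split; [|apply: finite_image]; exact: finite_Delta_F.
Qed.

(** The two cyclic orders in which three distinct colours can occur at 1, b, b^2. *)
Definition positive_triangle : set X :=
  [set x | cyclic3 (f x 1%g) (f x b) (f x (b * b)%g)].
Definition negative_triangle : set X :=
  [set x | cyclic3 (f x (b * b)%g) (f x b) (f x 1%g)].

Lemma measurable_positive_triangle : measurable positive_triangle.
Proof.
rewrite (_ : positive_triangle =
  [set x : X | f x b == ordS (f x 1%g)] `&` [set x : X | f x (b * b)%g == ordS (f x b)]).
  apply: measurableI; first exact: (measurable_colour_rel _ _ (fun k l => l == ordS k)).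
  exact: (measurable_colour_rel _ _ (fun k l => l == ordS k)).
by apply/seteqP; split=> x /=; rewrite /positive_triangle /= /cyclic3 => /andP.
Qed.

Lemma measurable_negative_triangle : measurable negative_triangle.
Proof.
rewrite (_ : negative_triangle =
  [set x : X | f x b == ordS (f x (b * b)%g)] `&` [set x : X | f x 1%g == ordS (f x b)]).
  apply: measurableI; first exact: (measurable_colour_rel _ _ (fun k l => l == ordS k)).
  exact: (measurable_colour_rel _ _ (fun k l => l == ordS k)).
by apply/seteqP; split=> x /=; rewrite /negative_triangle /= /cyclic3 => /andP.
Qed.

Definition orientation (x : X) : R :=
  \1_positive_triangle x + -1 * \1_negative_triangle x.

Lemma orientationE x : orientation x =
  (cyclic3 (f x 1%g) (f x b) (f x (b * b)%g))%:R
  - (cyclic3 (f x (b * b)%g) (f x b) (f x 1%g))%:R.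
Proof.
rewrite /orientation mulN1r !indicE; congr (_%:R - _%:R); congr nat_of_bool.
  by apply/idP/idP; rewrite inE.
by apply/idP/idP; rewrite inE.
Qed.

Lemma orientation_le1 x : `|orientation x| <= 1.
Proof.
rewrite orientationE; case: (boolP (cyclic3 (f x 1%g) _ _)) => [/cyclic3N ->|_].
  by rewrite subr0 normr1.
by case: (cyclic3 _ _ _); rewrite sub0r normrN ?normr1 ?normr0.
Qed.

Lemma orientation_approximable : approximable mu orientation.
Proof.
apply: approximableD; first exact: (approximable_indic mu measurable_positive_triangle).
exact/approximableN/(approximable_indic mu measurable_negative_triangle).
Qed.

(** By equivariance, the colouring of shift c x at 1 is that of x at c. The nine
    edges of the prism over {1, b, b^2} and its a_i-neighbour are all incident
    to one of the five vertices listed. *)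
Lemma orientation_flip i x :
  (forall c : Delta, f (shift c x) = translate c (f x)) ->
  {in [:: 1; b; b * b; a i; b * a i]%g, forall c, good (shift c x)} ->
  orientation x * orientation (shift (a i) x) = -1.
Proof.
move=> fx gx.
have neq c c' : c \in [:: 1; b; b * b; a i; b * a i]%g ->
    Delta_F c' \/ Delta_F (c'^-1)%g -> f x c != f x (c' * c)%g.
  move=> /gx/(_ c') gc Fc'; have /gc : cayley_adj Delta_F 1%g c'.
    by exists c'; rewrite ?mulg1.
  by rewrite fx /translate mul1g => /eqP.
have Fa : Delta_F (a i) \/ Delta_F (a i)^-1%g by left; left; exists i.
have Fb : Delta_F b \/ Delta_F b^-1%g by left; right.
have FbV : Delta_F (b * b)%g \/ Delta_F (b * b)^-1%g.
  by right; rewrite -Delta_bV invgK; right.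
have c01 := neq 1%g b; have c02 := neq 1%g (b * b)%g; have c0d0 := neq 1%g (a i).
have c12 := neq b b; have c1d2 := neq b (a i); have c2d1 := neq (b * b)%g (a i).
have d01 := neq (a i) b; have d02 := neq (a i) (b * b)%g; have d12 := neq (b * a i)%g b.
rewrite !inE !eqxx /= ?orbT ?mulg1 ?Delta_ab ?Delta_abb ?mulgA
  in c01 c02 c0d0 c12 c1d2 c2d1 d01 d02 d12.
have {}c01 := c01 erefl Fb. have {}c02 := c02 erefl FbV.
have {}c0d0 := c0d0 erefl Fa. have {}c12 := c12 erefl Fb.
have {}c1d2 := c1d2 erefl Fa. have {}c2d1 := c2d1 erefl Fa.
have {}d01 := d01 erefl Fb. have {}d02 := d02 erefl FbV. have {}d12 := d12 erefl Fb.
rewrite !orientationE !fx /translate mul1g.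
case/orP: (distinct_cyclic3 c01 c02 c12) => cyc.
  have cycd := prism_cyclic3 d01 d02 d12 c0d0 c1d2 c2d1 cyc.
  by rewrite cyc cycd (cyclic3N cyc) (cyclic3N cycd) sub0r subr0 mul1r.
(* Read from b^2 down to 1, the triangle at x is cyclic; its mirror image at a_i x
   then starts at b a_i. *)
have cycd : cyclic3 (f x (a i)) (f x (b * a i)%g) (f x (b * b * a i)%g).
  apply/cyclic3_rot.
  by apply: (prism_cyclic3 _ _ _ c2d1 c1d2 c0d0 cyc); rewrite // eq_sym.
by rewrite cyc cycd (cyclic3N cyc) (cyclic3N cycd) sub0r subr0 mulN1r.
Qed.

(** The product is -1 except where f fails to be equivariant, a null set, or to be
    proper at one of five vertices, each failure having the probability of the
    failure at 1. On the exceptional set the product is at most 1, that is, at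
    most -1 + 2; this gives the factor 10 = 2 * 5. *)
Lemma exp_orientation_flip i :
  \int[mu]_x (orientation x * orientation (shift (a i) x)) <=
  -1 + 10 * (1 - fine (mu good)).
Proof.
have [N [mN muN0 Nf]] := f_fiid.2.
have mgC : measurable (~` good : set X) by apply: measurableC; exact: measurable_good.
pose L : seq Delta := [:: 1; b; b * b; a i; b * a i]%g.
have bo : bounded_measurable orientation by case: orientation_approximable.
have bN : bounded_measurable (\1_N : X -> R) by exact: bm_indic.
have bg : bounded_measurable (\1_(~` good) : X -> R) by exact: bm_indic.
pose err (x : X) : R := \1_N x + \sum_(c <- L) \1_(~` good) (shift c x).
have bs : bounded_measurable (fun x => \sum_(c <- L) (\1_(~` good) (shift c x) : R)).
  by apply: bm_sum => c; exact: bm_shift.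
have berr : bounded_measurable err by exact: bmD.
have le_err x : orientation x * orientation (shift (a i) x) <= -1 + 2 * err x.
  have le1 : orientation x * orientation (shift (a i) x) <= 1.
    apply: le_trans (ler_norm _) _; rewrite normrM.
    by apply: mulr_ile1 => //; exact: orientation_le1.
  have ind0 (A : set X) y : 0 <= \1_A y :> R by rewrite indicE.
  have sum0 (r : seq Delta) : 0 <= \sum_(c <- r) \1_(~` good) (shift c x) :> R.
    by apply: sumr_ge0.
  suff : 1 <= err x \/ orientation x * orientation (shift (a i) x) = -1.
    case=> [|->]; first by move: le1; lra.
    have : 0 <= err x by rewrite addr_ge0.
    by lra.
  have [Nx|Nx] := pselect (N x).
    by left; rewrite /err indicE mem_set// lerDl.
  have [gx|/existsNP[c /not_implyP[cL gc]]] :=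
    pselect (forall c, c \in L -> good (shift c x)); last first.
    left; rewrite /err (big_rem c cL) /=.
    have -> : \1_(~` good) (shift c x) = 1 :> R by rewrite indicE mem_set.
    by rewrite addrCA lerDl addr_ge0.
  by right; apply: orientation_flip => //; apply: contra_notP Nx => /Nf.
have := exp_mono mu (bmM bo (bm_shift (a i) bo))
  (bmD (bm_cst _ (-1 : R)) (bmZ 2 berr)) le_err.
move=> /le_trans; apply.
rewrite expD ?expZ ?exp_cst//; [|exact: bm_cst|exact: bmZ].
have expL (r : seq Delta) :
    \int[mu]_x (\sum_(c <- r) \1_(~` good) (shift c x) : R) =
    (size r)%:R * (1 - fine (mu good)).
  elim: r => [|c r IHr].
    by under eq_Rintegral do rewrite big_nil; rewrite exp_cst mul0r.
  under eq_Rintegral do rewrite big_cons.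
  rewrite expD//; [|exact: bm_shift|by apply: bm_sum => c'; exact: bm_shift].
  rewrite IHr (exp_shift mu_power c bg) exp_indic// probability_setC;
    last exact: measurable_good.
  rewrite fineB ?fin_num_measure//; last exact: measurable_good.
  by rewrite /= -natr1 mulrDl mul1r addrC.
by rewrite expD// exp_indic// muN0 expL /= add0r mulrA -natrM.
Qed.

(** With p the probability in question, the gap gives
    3 - 30 * (1 - p) <= 17/6, that is, p <= 179/180. *)
Lemma proper_probability_le : fine (mu good) <= 179 / 180.
Proof.
have oa := orientation_approximable; have bo := oa.1.
have r_gt0 : 0 < 17 / 6 :> R by lra.
have := approximable_gap mu_power (@tree_weight_gt0 R) Delta_aK r_gt0
  (@tree_weight_super R) oa.
have var_le : Cov mu orientation orientation <= 1.
  apply: le_trans (cov_le_sqr _ _) _; rewrite -[leRHS](exp_cst mu 1).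
  apply: exp_mono; [exact: bmM|exact: bm_cst|move=> x].
  apply: le_trans (ler_norm _) _; rewrite normrM.
  by apply: mulr_ile1 => //; exact: orientation_le1.
have cov_le : Cov mu orientation (adjacency Delta_a orientation) <=
    3 * (-1 + 10 * (1 - fine (mu good))).
  rewrite cov_sumr//; last by move=> i; exact: bm_shift.
  apply: (@le_trans _ _ (\sum_(i < 3) (-1 + 10 * (1 - fine (mu good))))); last first.
    by rewrite sumr_const card_ord -[_ *+ 3]mulr_natl.
  apply: ler_sum => i _; apply: le_trans (exp_orientation_flip i).
  by rewrite /Cov (exp_shift mu_power)// gerBl -expr2 sqr_ge0.
have := ler_norm (- Cov mu orientation (adjacency Delta_a orientation)).
rewrite normrN; lra.
Qed.

End Colouring.

Theorem theorem4p8 (R : realType) (mu : probability (cube R Delta) R)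
  (mu_power : is_power_measure (unit_lebesgue (R := R)) mu) :
  ~ (exists f : nat -> cube R Delta -> labellings Delta,
       fiid_approx_coloring mu Delta_F f).
Proof.
move=> [f [f_fiid f_cvg]].
have /fine_cvg/cvgrPdist_lt/(_ (1 / 180)) :
    (fun i => mu (properly_coloured_at1 Delta_F (f i))) @ \oo --> (1 : R)%:E.
  exact: f_cvg.
have e0 : 0 < 1 / 180 :> R by lra.
move=> /(_ e0) [n _ /(_ n (leqnn n))] /=.
have := proper_probability_le mu_power (f_fiid n).
have := ler_norm (1 - fine (mu (properly_coloured_at1 Delta_F (f n)))); lra.
Qed.
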